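(* Fix $p\in(1,2]$, $r>0$ and a linear objective $C\in\mathbb{R}^{m\times n}$. Let $C=U\Sigma V^{\top}$ be the singular value decomposition of $C$. Let $\sigma$ be the vector such that $\sigma_i=-\frac{r}{\|\sigma(C)\|_q^{q-1}}\,\sigma(C)_i^{q-1}$, where $q$ satisfies $\frac1q+\frac1p=1$. Finally, let $X=U\,\mathrm{Diag}(\sigma)\,V^{\top}$, where $\mathrm{Diag}(\sigma)$ is the $m\times n$ diagonal matrix with the vector $\sigma$ as its main diagonal. Then $X=\arg\min_{Y\in\mathbb{B}_{S(p)}(r)}Y\bullet C$, where $\mathbb{B}_{S(p)}(r)=\{Y\in\mathbb{R}^{m\times n}:\|Y\|_{S(p)}\le r\}$.
   Context: For $X\in\mathbb{R}^{m\times n}$, $\sigma(X)$ denotes the vector of its $\min(m,n)$ singular values in descending order, and the Schatten $\ell_p$ norm is $\|X\|_{S(p)}=\|\sigma(X)\|_p=\left(\sum_{i=1}^{\min(m,n)}\sigma(X)_i^p\right)^{1/p}$. For $a\ge 1$, $\|\cdot\|_a$ applied to a vector is the usual $\ell_a$ norm. In the singular value decomposition, $U\in\mathbb{R}^{m\times m}$ and $V\in\mathbb{R}^{n\times n}$ are orthogonal and $\Sigma$ is the $m\times n$ diagonal matrix with main diagonal $\sigma(C)$. The symbol $\bullet$ denotes the standard inner product of matrices, $Y\bullet C=\mathrm{Tr}(Y^{\top}C)=\sum_{i,j}Y_{i,j}C_{i,j}$. *)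

(* Defs.v *)
From mathcomp Require Import all_boot all_order all_algebra.
From mathcomp Require Import boolp classical_sets reals exp.
From mathcomp Require polyrcf.
Set Implicit Arguments.
Unset Strict Implicit.
Unset Printing Implicit Defensive.
Import Order.TTheory GRing.Theory Num.Theory.
Local Open Scope classical_set_scope.
Local Open Scope ring_scope.

(* The real eigenvalues of A, repeated according to their multiplicity as roots
   of the characteristic polynomial, in descending order. *)
Definition eigenvalues_desc (R : realType) (n : nat) (A : 'M[R]_n) : seq R :=
  sort >=%O (flatten [seq nseq (mup x (char_poly A)) x
                     | x <- polyrcf.rootsR (char_poly A)]).

(* X^T *m X is n x n and has n eigenvalues; the n - minn m n smallest ones,
   which necessarily vanish, are left out. *)
Definition singvals (R : realType) (m n : nat) (X : 'M[R]_(m, n)) :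
    'rV[R]_(minn m n) :=
  \row_(i < minn m n) Num.sqrt (nth 0 (eigenvalues_desc (X^T *m X)) i).

Definition lpnorm (R : realType) (p : R) (k : nat) (v : 'rV[R]_k) : R :=
  (\sum_(i < k) `|v 0 i| `^ p) `^ p^-1.

Definition schatten (R : realType) (p : R) (m n : nat) (X : 'M[R]_(m, n)) : R :=
  lpnorm p (singvals X).

Definition schatten_ball (R : realType) (p : R) (m n : nat) (r : R) :
    set 'M[R]_(m, n) :=
  [set Y | schatten p Y <= r].

(* The sum has one term when i = j and is empty otherwise. *)
Definition Diag (R : realType) (m n : nat) (s : 'rV[R]_(minn m n)) :
    'M[R]_(m, n) :=
  \matrix_(i < m, j < n)
    \sum_(k < minn m n | (k == i :> nat) && (k == j :> nat)) s 0 k.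

Definition orthogonal_mx (R : realType) (n : nat) (U : 'M[R]_n) : Prop :=
  U^T *m U = 1%:M.

Definition is_svd (R : realType) (m n : nat)
    (C : 'M[R]_(m, n)) (U : 'M[R]_m) (V : 'M[R]_n) : Prop :=
  [/\ orthogonal_mx U, orthogonal_mx V & C = U *m Diag (singvals C) *m V^T].

Definition mxinner (R : realType) (m n : nat) (Y C : 'M[R]_(m, n)) : R :=
  \tr (Y^T *m C).

Definition argmin (R : realType) (T : Type) (B : set T) (f : T -> R) : set T :=
  [set x | B x /\ forall y, B y -> f x <= f y].

(* Main.v *)
Require Import Defs.
From mathcomp Require Import all_boot all_order all_algebra.
From mathcomp Require Import boolp classical_sets reals sequences exp.
From mathcomp Require Import ring lra complex.
From mathcomp Require polyrcf.
Set Implicit Arguments.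
Unset Strict Implicit.
Unset Printing Implicit Defensive.
Import Order.TTheory GRing.Theory Num.Theory.
Local Open Scope classical_set_scope.
Local Open Scope ring_scope.

(* Put [W = - U^T Y V].  It has the singular values of [Y], and [Y . C] is minus
   the sum of [sigma(C)_k * W_kk].  With [W = A D B^T] a singular value
   decomposition, [W_kk] is the sum over [i] of [A_ki d_i B_ki], where
   [|A_ki B_ki| <= (A_ki^2 + B_ki^2) / 2] and the latter weights are doubly
   substochastic.  Young's inequality applied to each product
   [sigma(C)_k * d_i] bounds the sum by its value at [W = Diag (- sigma)].  In the
   equality case, [d_i] is the [k]-th entry of [- sigma] and [A_ki = B_ki] whenever
   the weight of [(k, i)] and the entry do not vanish, and orthogonality of the
   rows of [B] then forces [W = Diag (- sigma)]. *)

(** * Spectral theorem for real symmetric matrices *)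

Lemma mulmx_tr00E (R : comNzRingType) (n : nat) (v w : 'rV[R]_n) :
  (v *m w^T) 0 0 = \sum_i v 0 i * w 0 i.
Proof. by rewrite mxE; apply: eq_bigr => i _; rewrite mxE. Qed.

Lemma sqnorm_gt0 (R : realDomainType) (n : nat) (v : 'rV[R]_n) :
  (0 < (v *m v^T) 0 0) = (v != 0).
Proof.
have sq_ge0 i : 0 <= v 0 i * v 0 i by rewrite -expr2 sqr_ge0.
rewrite mulmx_tr00E lt0r sumr_ge0 // andbT; congr (~~ _).
rewrite psumr_eq0 //; apply/allP/eqP => [v0|-> i _]; last by rewrite /= mxE mulr0 eqxx.
by apply/rowP => i; have /= := v0 i (mem_index_enum i); rewrite mulf_eq0 orbb mxE => /eqP.
Qed.

(** Over the complex numbers [A] becomes Hermitian, hence unitarily diagonalisable with real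
    spectrum. A row of the diagonalising matrix is a left eigenvector, and the eigenvalue descends
    to [A] through the characteristic polynomial. *)
Lemma symmetric_eigenvalue (R : rcfType) (n : nat) (A : 'M[R]_n.+1) :
  A^T = A -> exists a, eigenvalue A a.
Proof.
pose f : {rmorphism R -> complex R} := real_complex R.
move=> symA; pose M : 'M[complex R]_n.+1 := map_mx f A.
have hM : M \is hermsymmx.
  apply: realsym_hermsym.
    by apply/is_hermitianmxP; rewrite expr0 scale1r map_mx_id // /M map_trmx symA.
  by apply/mxOverP => i j; rewrite mxE; apply/complex_realP; exists (A i j).
have /mxOverP/(_ 0 0)/complex_realP[a Ea] := hermitian_spectral_diag_real hM.
have /hermitian_normalmx/orthomx_spectralP EM := hM.
exists a; rewrite eigenvalue_root_char -(fmorph_root f) map_char_poly.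
rewrite -eigenvalue_root_char; apply/eigenvalueP.
exists (row 0 (spectralmx M)).
  rewrite -[map_mx _ _]/M {2}EM -row_mul !mulmxA mulmxV ?spectral_unit // mul1mx.
  by apply/rowP => j; rewrite mul_diag_mx !mxE Ea.
apply: contraTneq (spectral_unit M) => row0.
by rewrite -row_free_unit; apply/row_freePn; exists 0; rewrite row0 sub0mx.
Qed.

(* For [v <> e], where [e] is the first basis vector, the reflection in the
   hyperplane orthogonal to [e - v] exchanges [e] and [v]. *)
Lemma householder (R : realFieldType) (n : nat) (v : 'rV[R]_n.+1) :
  v *m v^T = 1%:M ->
  exists H : 'M[R]_n.+1, [/\ H^T = H, H *m H = 1%:M & row 0 H = v].
Proof.
move=> v1; pose e : 'rV[R]_n.+1 := delta_mx 0 0.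
have [w Ew] : exists w, w = e - v by exists (e - v).
have ev : e *m v^T = (v 0 0)%:M.
  by apply/rowP => i; rewrite ord1 mxE (bigD1 0) //= big1 => [|j jn0];
    rewrite !mxE ?eqxx ?mul1r ?addr0 ?(negbTE jn0) ?andbF ?mul0r.
have ve : v *m e^T = (v 0 0)%:M by rewrite -[v]trmxK -trmx_mul ev tr_scalar_mx trmxK.
have ee : e *m e^T = 1%:M.
  by rewrite trmx_delta mul_delta_mx; apply/matrixP => i j; rewrite !ord1 !mxE.
have ww : w *m w^T = (2 * (1 - v 0 0))%:M.
  rewrite Ew linearB /= mulmxBl !mulmxBr v1 ev ve ee.
  by apply/rowP => i; rewrite !ord1 !mxE eqxx !mulr1n; ring.
have ew : e *m w^T = (1 - v 0 0)%:M.
  by rewrite Ew linearB /= mulmxBr ee ev -raddfB.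
have [/eqP|w0] := eqVneq w 0.
  rewrite Ew subr_eq0 => /eqP Ev; exists 1%:M.
  by rewrite tr_scalar_mx mul1mx -Ev row1.
have v0 : 1 - v 0 0 != 0.
  by move: w0; rewrite -sqnorm_gt0 ww mxE eqxx mulr1n; apply: contraTneq => ->; lra.
(* This is 2 divided by the squared length of [w], the usual factor in a reflection. *)
pose c := (1 - v 0 0)^-1.
exists (1%:M - c *: (w^T *m w)); split.
- by rewrite linearB linearZ /= tr_scalar_mx trmx_mul trmxK.
- rewrite mulmxBl !mulmxBr !mul1mx mulmx1 -scalemxAl -scalemxAr scalerA.
  rewrite -mulmxA [w *m (_ *m _)]mulmxA ww mul_scalar_mx -scalemxAr scalerA.
  have -> : c * c * (2 * (1 - v 0 0)) = c + c by rewrite /c; field.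
  by rewrite scalerDl; apply/matrixP => i j; rewrite !mxE; ring.
- rewrite rowE -/e mulmxBr mulmx1 -scalemxAr mulmxA.
  by rewrite ew mul_scalar_mx scalerA mulVf // scale1r Ew opprB addrC subrK.
Qed.

(** Deflation: a reflection whose first row is a unit eigenvector conjugates [A] to a symmetric
    matrix with first row [a] times the first basis vector. By symmetry this matrix is block
    diagonal, and induction applies to its lower right block. *)
Theorem real_spectral (R : rcfType) (n : nat) (A : 'M[R]_n) :
  A^T = A ->
  exists (B : 'M[R]_n) (d : 'rV[R]_n),
    B^T *m B = 1%:M /\ A = B *m diag_mx d *m B^T.
Proof.
elim: n A => [|n IHn] A symA.
  by exists 1%:M, 0; split; apply/matrixP => -[].
have [a /eigenvalueP[u uA u0]] := symmetric_eigenvalue symA.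
pose N := (u *m u^T) 0 0; have N_gt0 : 0 < N by rewrite sqnorm_gt0.
pose v := (Num.sqrt N)^-1 *: u.
have vA : v *m A = a *: v by rewrite -scalemxAl uA !scalerA mulrC.
have v1 : v *m v^T = 1%:M.
  rewrite linearZ /= -scalemxAl -scalemxAr scalerA [u *m _]mx11_scalar -/N.
  by rewrite scale_scalar_mx -invfM -expr2 sqr_sqrtr ?ltW // mulVf ?gt_eqF.
have [H [symH HH Hv]] := householder v1.
pose D : 'M_(1 + n) := H *m A *m H.
have symD : D^T = D by rewrite !trmx_mul symH symA mulmxA.
have rowD : row 0 D = a *: delta_mx 0 0.
  rewrite !row_mul Hv vA -scalemxAl; congr (_ *: _).
  by rewrite -Hv -row_mul HH row1.
have D00 : ulsubmx D = a%:M.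
  apply/rowP => j; rewrite !ord1 !mxE.
  by have /rowP/(_ 0) := rowD; rewrite !mxE eqxx mulr1n mulr1 lshift0.
have D0r : ursubmx D = 0.
  apply/rowP => j; have /rowP/(_ (rshift 1 j)) := rowD.
  by rewrite !mxE lshift0 /= mulr0.
have Dr0 : dlsubmx D = 0 by rewrite -symD -trmx_ursub D0r trmx0.
have [|B' [d [B'1 ED]]] := IHn (drsubmx D); first by rewrite trmx_drsub symD.
pose B : 'M_(1 + n) := block_mx 1%:M 0 0 B'.
have BT : B^T = block_mx 1%:M 0 0 B'^T by rewrite tr_block_mx !trmx0 trmx1.
have BB : B^T *m B = 1%:M.
  rewrite BT mulmx_block !(mulmx0, mul0mx, mul1mx, addr0, add0r).
  by rewrite B'1 -scalar_mx_block.
have DB : D = B *m diag_mx (row_mx a%:M d) *m B^T.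
  rewrite BT -[LHS]submxK D00 D0r Dr0 diag_mx_row !mulmx_block.
  rewrite !(mulmx0, mul0mx, mul1mx, mulmx1, addr0, add0r) ED.
  by congr (block_mx _ _ _ _); apply/rowP => j; rewrite !ord1 !mxE eqxx.
exists (H *m B), (row_mx a%:M d); split.
  by rewrite trmx_mul symH -mulmxA [H *m (_ *m _)]mulmxA HH mul1mx.
have -> : A = H *m D *m H by rewrite /D !mulmxA HH mul1mx -mulmxA HH mulmx1.
by rewrite trmx_mul symH DB !mulmxA.
Qed.

(** * Singular values from a diagonalisation of the Gram matrix *)

Lemma char_poly_orthogonal_conj (R : realType) (n : nat) (B D : 'M[R]_n) :
  orthogonal_mx B -> char_poly (B *m D *m B^T) = char_poly D.
Proof.
move=> BB; have BB' := mulmx1C BB.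
pose f : 'M[R]_n -> 'M[{poly R}]_n := map_mx polyC.
have fBB : f B *m f B^T = 1%:M by rewrite -map_mxM BB' map_mx1.
rewrite /char_poly.
have -> : char_poly_mx (B *m D *m B^T) = f B *m char_poly_mx D *m f B^T.
  rewrite mulmxBr mulmxBl -!map_mxM; congr (_ - _).
  by rewrite mul_mx_scalar -scalemxAl fBB scalemx1.
by rewrite !det_mulmx mulrAC -det_mulmx fBB det1 mul1r.
Qed.

Lemma char_poly_diag_mx (R : comNzRingType) (n : nat) (d : 'rV[R]_n) :
  char_poly (diag_mx d) = \prod_(i < n) ('X - (d 0 i)%:P).
Proof.
rewrite char_poly_trig ?diag_mx_is_trig //.
by apply: eq_bigr => i _; rewrite mxE eqxx.
Qed.

(** The list of real roots has no repetition, so each [x] occurs in the sorted list as often as its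
    multiplicity, which is also its number of occurrences in [e]. *)
Lemma perm_eigenvalues_desc (R : realType) (n : nat) (A : 'M[R]_n) (e : seq R) :
  char_poly A = \prod_(x <- e) ('X - x%:P) -> perm_eq (eigenvalues_desc A) e.
Proof.
move=> Ee; rewrite /eigenvalues_desc perm_sort; apply/allP => x _ /=; apply/eqP.
rewrite count_flatten -map_comp -mu_prod_XsubC -Ee.
have sum_count (f : R -> nat) r :
    sumn (map (count_mem x \o fun y => nseq (f y) y) r) = (count_mem x r * f x)%N.
  elim: r => //= y r ->; rewrite count_nseq mulnDl /=.
  by have [->|_] := eqVneq y x; rewrite ?eqxx ?mul0n.
rewrite sum_count.
have p0 : char_poly A != 0 by rewrite monic_neq0 ?char_poly_monic.
have [px|npx] := boolP (root (char_poly A) x); last by rewrite (mupNroot npx) muln0.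
rewrite count_uniq_mem ?polyrcf.uniq_roots //.
have /polyrcf.roots_onP/(_ x) := polyrcf.roots_on_rootsR p0.
by rewrite inE px => /(_ isT) /= <-; rewrite mul1n.
Qed.

(** In a descending nonnegative list the zeros come last, so the first [k] positions contain every
    nonzero entry. Positions past the end read the default [0], which [F] kills. *)
Lemma sum_sorted_support (R : realDomainType) (V : nmodType) (F : R -> V)
    (s : seq R) (k : nat) :
  F 0 = 0 -> sorted >=%O s -> all (>= 0) s -> (count (predC1 0%R) s <= k)%N ->
  \sum_(i < k) F (nth 0 s i) = \sum_(x <- s) F x.
Proof.
move=> F0; elim: s k => [|x s IHs] k.
  by rewrite big_nil big1 // => i _; rewrite nth_nil.
rewrite /= path_sortedE; last exact: ge_trans.
move=> /andP[/allP s_le s_sorted] /andP[x_ge0 s_ge0].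
have [x0|x_neq0] /= := eqVneq x 0; last first.
  case: k => // k; rewrite add1n ltnS => s_k.
  by rewrite big_ord_recl big_cons /= IHs.
move=> _; have s0 y : y \in x :: s -> y = 0.
  rewrite inE => /predU1P[->//|ys]; apply/le_anti.
  by rewrite -{1}x0 [_ <= x](s_le y ys) (allP s_ge0).
rewrite [RHS]big1_seq => [|y /andP[_ /s0->]//]; apply: big1 => i _.
have [si|si] := ltnP i (size (x :: s)); last by rewrite nth_default.
by rewrite (s0 (nth 0 (x :: s) i)) // mem_nth.
Qed.

(** Any orthogonal diagonalisation of the Gram matrix serves, sorted or not. The bound on the
    support ensures that truncation to [minn m n] values drops only zeros. *)
Lemma sum_singvals (R : realType) (m n : nat) (Y : 'M[R]_(m, n)) (B : 'M[R]_n)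
    (d : 'rV[R]_n) (p : R) :
  p != 0 -> orthogonal_mx B -> Y^T *m Y = B *m diag_mx d *m B^T ->
  (forall i, 0 <= d 0 i) -> (#|[pred i | d ord0 i != 0%R]| <= minn m n)%N ->
  \sum_k `|singvals Y 0 k| `^ p = \sum_i Num.sqrt (d 0 i) `^ p.
Proof.
move=> p0 BB EY d_ge0 card_d.
have ev : perm_eq (eigenvalues_desc (Y^T *m Y)) [seq d 0 i | i <- index_enum 'I_n].
  apply: perm_eigenvalues_desc.
  by rewrite EY char_poly_orthogonal_conj // char_poly_diag_mx big_map.
transitivity (\sum_(k < minn m n)
    Num.sqrt (nth 0 (eigenvalues_desc (Y^T *m Y)) k) `^ p).
  by apply: eq_bigr => k _; rewrite mxE ger0_norm ?sqrtr_ge0.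
rewrite (sum_sorted_support (F := fun x => Num.sqrt x `^ p)).
- by rewrite (perm_big _ ev) big_map.
- by rewrite sqrtr0 powR0.
- by apply: sort_sorted => x y; exact: le_total.
- by rewrite (perm_all _ ev); apply/allP => _ /mapP[i _ ->].
- rewrite (permP ev) count_map; apply: leq_trans card_d.
  by rewrite -sum1_count -sum1_card.
Qed.

(** * Bessel's inequality and the thin singular value decomposition *)

(** With [P = A *m A^T] and [x = P k k], the bound on [e] gives [(P *m P) k k <= x], and symmetry of
    [P] gives [x ^+ 2 <= (P *m P) k k]. Hence [x ^+ 2 <= x]. *)
Lemma bessel (R : realDomainType) (m n : nat) (A : 'M[R]_(m, n)) (e : 'rV[R]_n) :
  A^T *m A = diag_mx e -> (forall j, e 0 j <= 1) ->
  forall k, \sum_j A k j ^+ 2 <= 1.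
Proof.
move=> AA e_le1 k; set x := \sum_j _.
have [P EP] : exists P, P = A *m A^T by exists (A *m A^T).
have Pkk : P k k = x.
  by rewrite EP mxE; apply: eq_bigr => j _; rewrite mxE expr2.
have x_ge0 : 0 <= x by apply: sumr_ge0 => j _; exact: sqr_ge0.
suff xx : x ^+ 2 <= x.
  rewrite leNgt; apply: contraL xx => x1.
  by rewrite -ltNge expr2 ltr_pMr // (lt_trans ltr01).
have symP : P^T = P by rewrite EP trmx_mul trmxK.
have PP : (P *m P) k k <= x.
  rewrite EP mulmxA -[A *m _ *m A]mulmxA AA mxE; apply: ler_sum => j _.
  rewrite mul_mx_diag !mxE mulrAC -expr2 ler_piMr ?sqr_ge0 //.
have PPkk : (P *m P) k k = \sum_l P k l ^+ 2.
  by rewrite mxE; apply: eq_bigr => l _; rewrite expr2 -{2}symP mxE.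
apply: le_trans PP; rewrite PPkk (bigD1 k) //= Pkk lerDl.
by apply: sumr_ge0 => l _; exact: sqr_ge0.
Qed.

(** An orthogonal [B] diagonalising [Y^T *m Y] makes the columns of [Y *m B] pairwise orthogonal,
    and [A] arises by normalising them. Zero columns stay zero, so [A] is in general only a partial
    isometry. *)
Lemma thin_svd (R : rcfType) (m n : nat) (Y : 'M[R]_(m, n)) :
  exists (A : 'M[R]_(m, n)) (B : 'M[R]_n) (d : 'rV[R]_n),
    [/\ B^T *m B = 1%:M, A^T *m A = diag_mx (\row_j (d 0 j != 0)%:R),
        forall j, 0 <= d 0 j & Y = A *m diag_mx d *m B^T].
Proof.
have [|B [l [BB Yl]]] := real_spectral (A := Y^T *m Y).
  by rewrite trmx_mul trmxK.
have ZZ : (Y *m B)^T *m (Y *m B) = diag_mx l.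
  rewrite trmx_mul -mulmxA [Y^T *m _]mulmxA Yl !mulmxA BB mul1mx.
  by rewrite -mulmxA BB mulmx1.
have lE j : l 0 j = \sum_k (Y *m B) k j ^+ 2.
  have /matrixP/(_ j j) := ZZ; rewrite !mxE eqxx mulr1n => <-.
  by apply: eq_bigr => k _; rewrite !mxE expr2.
have l_ge0 j : 0 <= l 0 j.
  by rewrite lE; apply: sumr_ge0 => k _; exact: sqr_ge0.
pose d := \row_j Num.sqrt (l 0 j).
(* Here [0^-1 = 0], so a column with [d 0 j = 0] becomes zero. *)
pose A := Y *m B *m diag_mx (\row_j (d 0 j)^-1).
exists A, B, d; split => // [|j|].
- rewrite trmx_mul tr_diag_mx mulmxA -[_ *m _ *m (Y *m B)]mulmxA ZZ -!mulmxA.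
  rewrite !mulmx_diag; congr diag_mx; apply/rowP => j; rewrite !mxE.
  move: (sqr_sqrtr (l_ge0 j)); set x := Num.sqrt _ => <-.
  have [->|x0] := eqVneq x 0; first by rewrite expr0n mul0r mulr0.
  by rewrite expr2 mulfK // mulVf.
- by rewrite mxE sqrtr_ge0.
- have -> : A *m diag_mx d = Y *m B; last by rewrite -mulmxA (mulmx1C BB) mulmx1.
  rewrite -mulmxA mulmx_diag mul_mx_diag; apply/matrixP => k j; rewrite !mxE.
  (* [l 0 j] is the squared length of column [j] of [Y *m B]; where it vanishes the column does too,
     and nothing is lost. *)
  have [|dj] := eqVneq (Num.sqrt (l 0 j)) 0; last by rewrite mulVf // mulr1.
  move=> /eqP; rewrite sqrtr_eq0 => l_le0.
  have l0 : l 0 j == 0 by rewrite eq_le l_le0 l_ge0.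
  move: l0; rewrite lE psumr_eq0 => [/allP/(_ k (mem_index_enum k))|i _]; last exact: sqr_ge0.
  by rewrite /= sqrf_eq0 mxE => /eqP ->; rewrite !mul0r.
Qed.

(* The trace of [A^T *m A] counts its nonzero diagonal entries, and the trace of
   [A *m A^T] is at most [m] by Bessel's inequality. *)
Lemma card_support_partial_isometry (R : realDomainType) (m n : nat)
    (A : 'M[R]_(m, n)) (d : 'rV[R]_n) :
  A^T *m A = diag_mx (\row_j (d 0 j != 0)%:R) ->
  (#|[pred j | d ord0 j != 0%R]| <= minn m n)%N.
Proof.
move=> AA; rewrite leq_min andbC.
have -> /= : (#|[pred j | d ord0 j != 0%R]| <= n)%N.
  by rewrite -[leqRHS]card_ord max_card.
rewrite -(ler_nat R) -sum1_card natr_sum big_mkcond /=.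
have -> : \sum_j (if j \in [pred j | d ord0 j != 0%R] then 1%:R else 0) = \tr (A *m A^T) :> R.
  rewrite mxtrace_mulC AA mxtrace_diag; apply: eq_bigr => j _.
  by rewrite mxE inE; case: eqP.
rewrite -[X in X%:R]card_ord -sum1_card natr_sum; apply: ler_sum => k _.
rewrite mxE (eq_bigr (fun j => A k j ^+ 2)) => [|j _]; last by rewrite mxE expr2.
by apply: (bessel AA) => j; rewrite mxE lern1; case: eqP.
Qed.

(** * Young's inequality with its equality case *)

(** The bound is the tangent line at [t] of the [p]-th power, which is strictly convex; hence
    equality only at [d = t]. *)
Lemma powR_young (R : realType) (p t d : R) : 1 < p -> 0 <= t -> 0 <= d ->
  p * t `^ (p - 1) * d <= d `^ p + (p - 1) * t `^ p ?= iff (d == t).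
Proof.
move=> p1 t0 d0; have p0 : p != 0 by lra.
have p10 : p - 1 != 0 by lra.
have [->|tn0] := eqVneq t 0.
  rewrite !powR0 // !(mulr0, mul0r) addr0; split; first exact: powR_ge0.
  by rewrite eq_sym powR_eq0 p0 andbT.
have t_gt0 : 0 < t by rewrite lt0r tn0.
have [<-|dt] := eqVneq d t.
  split; last by rewrite -(mulr_powRB1 d0 (lt_trans ltr01 p1)); apply/eqP; ring.
  by rewrite -(mulr_powRB1 d0 (lt_trans ltr01 p1)); lra.
suff lt : p * t `^ (p - 1) * d < d `^ p + (p - 1) * t `^ p.
  by split; [exact: ltW | rewrite lt_eqF].
have tp : 0 < t `^ p by exact: powR_gt0.
have [->|dn0] := eqVneq d 0.
  by rewrite mulr0 powR0 // add0r mulr_gt0 // subr_gt0.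
have d_gt0 : 0 < d by rewrite lt0r dn0.
(* With [d = t * expR u] and after division by [d * t `^ (p - 1)], the claim is
   [p < expR ((p - 1) * u) + (p - 1) * expR (- u)], which follows from
   [1 + x < expR x] applied to both exponentials. *)
pose u := ln (d / t).
have dE : d = t * expR u by rewrite lnK ?posrE ?divr_gt0 // mulrC divfK.
have u0 : u != 0.
  by apply: contraNneq dt => u0; rewrite dE u0 expR0 mulr1.
have e1 : 1 + (p - 1) * u < expR ((p - 1) * u).
  by apply: expR_gt1Dx; rewrite mulf_neq0.
have e2 : 1 - u < expR (- u) by apply: expR_gt1Dx; rewrite oppr_eq0.
have dp : d `^ p = t `^ p * expR u * expR ((p - 1) * u).
  rewrite dE powRM ?expR_ge0 ?(ltW t_gt0) // -mulrA -expRD; congr (_ * _).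
  by rewrite /powR gt_eqF ?expR_gt0 // expRK; congr expR; ring.
have tE : t `^ p = t `^ p * expR u * expR (- u).
  by rewrite -mulrA -expRD subrr expR0 mulr1.
have -> : p * t `^ (p - 1) * d = t `^ p * expR u * p.
  rewrite [in LHS]dE -(mulr_powRB1 (ltW t_gt0) (lt_trans ltr01 p1)); ring.
have -> : (p - 1) * t `^ p = t `^ p * expR u * ((p - 1) * expR (- u)).
  by rewrite {1}tE; ring.
rewrite dp -mulrDr ltr_pM2l ?mulr_gt0 ?expR_gt0 //.
have : (p - 1) * (1 - u) < (p - 1) * expR (- u) by rewrite ltr_pM2l // subr_gt0.
lra.
Qed.

(** * Rectangular diagonal matrices *)

Lemma sum_widen_ord (V : nmodType) (N n : nat) (leNn : (N <= n)%N) (G : 'I_n -> V) :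
  (forall i : 'I_n, (N <= i)%N -> G i = 0) ->
  \sum_i G i = \sum_(k < N) G (widen_ord leNn k).
Proof.
move=> G0; rewrite (bigID (fun i : 'I_n => (i < N)%N)) /= (big_ord_narrow leNn).
by rewrite [X in _ + X]big1 ?addr0 // => i; rewrite -leqNgt; exact: G0.
Qed.

Lemma ler_sum_widen_ord (R : numDomainType) (N n : nat) (leNn : (N <= n)%N)
    (G : 'I_n -> R) :
  (forall i, 0 <= G i) -> \sum_(k < N) G (widen_ord leNn k) <= \sum_i G i.
Proof.
move=> G_ge0; rewrite [leRHS](bigID (fun i : 'I_n => (i < N)%N)) /= (big_ord_narrow leNn).
by rewrite lerDl sumr_ge0.
Qed.

Lemma DiagE (R : realType) (m n : nat) (s : 'rV[R]_(minn m n)) k j :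
  Diag s (widen_ord (geq_minl m n) k) j = s 0 k *+ (k == j :> nat).
Proof.
rewrite mxE; have [kj|kj] := eqVneq (k : nat) j.
  rewrite (big_pred1 k) // => i /=; rewrite -kj andbb.
  by apply/eqP/eqP => [/val_inj|->].
rewrite big_pred0 // => i; apply/negP => /andP[/eqP/= ik /eqP ij].
by move: kj; rewrite -ij -ik eqxx.
Qed.

Lemma Diag_ge (R : realType) (m n : nat) (s : 'rV[R]_(minn m n)) (i : 'I_m) j :
  (minn m n <= i)%N -> Diag s i j = 0.
Proof.
move=> le_i; rewrite mxE big_pred0 // => k; apply/negP => /andP[/eqP ki _].
by move: le_i; rewrite -ki leqNgt ltn_ord.
Qed.

Lemma mxinner_Diag (R : realType) (m n : nat) (W : 'M[R]_(m, n))
    (s : 'rV[R]_(minn m n)) :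
  mxinner W (Diag s) =
    \sum_k s 0 k * W (widen_ord (geq_minl m n) k) (widen_ord (geq_minr m n) k).
Proof.
rewrite /mxinner mxtrace_mulC.
rewrite /mxtrace (sum_widen_ord (geq_minl m n)) => [|i le_i]; last first.
  by rewrite mxE big1 // => j _; rewrite Diag_ge ?mul0r.
apply: eq_bigr => k _; rewrite mxE (bigD1 (widen_ord (geq_minr m n) k)) //=.
rewrite DiagE eqxx mulr1n mxE big1 ?addr0 // => j jk.
rewrite DiagE; case: eqP => [kj|_]; last by rewrite mul0r.
by move: jk; rewrite -val_eqE /= -kj eqxx.
Qed.

(** * Duality for the Schatten norm and its equality case *)

(* If [W = A *m diag_mx d *m B^T], the weights
   [w k i = (A k i ^+ 2 + B k i ^+ 2) / 2] are doubly substochastic, and the gap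
   between the two sides is a sum of nonnegative terms: the slack in Young's
   inequality between [t k] and [d i], weighted by [w k i]; the slack in
   [A k i * B k i <= w k i]; and the defects of the row and column sums of [w]. *)
Lemma schatten_duality (R : realType) (m n : nat) (p : R) (W : 'M[R]_(m, n))
    (t : 'rV[R]_(minn m n)) :
  1 < p -> (forall k, 0 <= t 0 k) ->
  \sum_k `|singvals W 0 k| `^ p <= \sum_k t 0 k `^ p ->
  mxinner W (Diag (\row_k t 0 k `^ (p - 1))) <= \sum_k t 0 k `^ p /\
  (mxinner W (Diag (\row_k t 0 k `^ (p - 1))) = \sum_k t 0 k `^ p -> W = Diag t).
Proof.
move=> p1 t_ge0; have p0 : 0 < p by rewrite (lt_trans ltr01).
have [A [B [d [BB AA d_ge0 EW]]]] := thin_svd W.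
have BBt : B *m B^T = 1%:M by exact: mulmx1C.
(* [A^T *m A] projects onto the support of [d], so it is absorbed by [diag_mx d]. *)
have WW : W^T *m W = B *m diag_mx (\row_i d 0 i ^+ 2) *m B^T.
  rewrite EW !trmx_mul trmxK tr_diag_mx -!mulmxA [A^T *m _]mulmxA AA.
  congr (B *m _); rewrite !mulmxA; congr (_ *m B^T); rewrite !mulmx_diag.
  congr diag_mx; apply/rowP => i; rewrite !mxE expr2.
  by case: eqP => [->|_]; rewrite ?mulr1 ?mul0r.
rewrite (sum_singvals (B := B) (d := \row_i d 0 i ^+ 2)) ?gt_eqF //; last 2 first.
- by move=> i; rewrite mxE sqr_ge0.
- apply: leq_trans (card_support_partial_isometry AA); apply: subset_leq_card.
  by apply/fintype.subsetP => i; rewrite !inE mxE sqrf_eq0.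
under eq_bigr => i _ do rewrite mxE sqrtr_sqr ger0_norm //.
move=> sum_dt.
pose u k i := A (widen_ord (geq_minl m n) k) i.
pose v k i := B (widen_ord (geq_minr m n) k) i.
pose w k i := (u k i ^+ 2 + v k i ^+ 2) / 2.
have w_ge0 k i : 0 <= w k i by rewrite divr_ge0 ?addr_ge0 ?sqr_ge0.
have A_row k : \sum_i A k i ^+ 2 <= 1.
  by apply: (bessel AA) => j; rewrite mxE lern1; case: eqP.
have B_row k : \sum_i B k i ^+ 2 = 1.
  have /matrixP/(_ k k) := BBt; rewrite !mxE eqxx mulr1n => <-.
  by apply: eq_bigr => i _; rewrite mxE expr2.
have A_col i : \sum_k A k i ^+ 2 <= 1.
  have /matrixP/(_ i i) := AA; rewrite !mxE eqxx mulr1n => E.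
  rewrite [leLHS](_ : _ = (d 0 i != 0)%:R); first by rewrite lern1; case: eqP.
  by rewrite -E; apply: eq_bigr => k _; rewrite mxE expr2.
have B_col i : \sum_k B k i ^+ 2 = 1.
  have /matrixP/(_ i i) := BB; rewrite !mxE eqxx mulr1n => <-.
  by apply: eq_bigr => k _; rewrite mxE expr2.
have sumu i : \sum_k u k i ^+ 2 <= 1.
  apply: le_trans (A_col i).
  by apply: (ler_sum_widen_ord (geq_minl m n) (G := fun k => A k i ^+ 2)) => k; exact: sqr_ge0.
have sumv i : \sum_k v k i ^+ 2 <= 1.
  rewrite -(B_col i).
  by apply: (ler_sum_widen_ord (geq_minr m n) (G := fun k => B k i ^+ 2)) => k; exact: sqr_ge0.
have w_row k : \sum_i w k i <= 1.
  by rewrite -mulr_suml big_split /= B_row; have := A_row (widen_ord (geq_minl m n) k); lra.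
have w_colE i : \sum_k w k i = (\sum_k u k i ^+ 2 + \sum_k v k i ^+ 2) / 2.
  by rewrite -mulr_suml big_split.
have w_col i : \sum_k w k i <= 1.
  by rewrite w_colE; have := sumu i; have := sumv i; lra.
pose Y k i := d 0 i `^ p + (p - 1) * t 0 k `^ p - p * t 0 k `^ (p - 1) * d 0 i.
have Y_ge0 k i : 0 <= Y k i.
  by rewrite subr_ge0; have [] := powR_young p1 (t_ge0 k) (d_ge0 i).
pose z k i := p * t 0 k `^ (p - 1) * d 0 i * ((u k i - v k i) ^+ 2 / 2).
have z_ge0 k i : 0 <= z k i.
  apply: mulr_ge0; last by rewrite divr_ge0 ?sqr_ge0.
  by rewrite mulr_ge0 ?d_ge0 // mulr_ge0 ?powR_ge0 ?ltW.
pose a i := d 0 i `^ p * (1 - \sum_k w k i).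
pose b k := (p - 1) * t 0 k `^ p * (1 - \sum_i w k i).
have a_ge0 i : 0 <= a i by rewrite mulr_ge0 ?powR_ge0 ?subr_ge0.
have b_ge0 k : 0 <= b k by rewrite !mulr_ge0 ?powR_ge0 ?subr_ge0 // ltW.
have WE k l : W k l = \sum_i A k i * d 0 i * B l i.
  by rewrite EW mxE; apply: eq_bigr => i _; rewrite mul_mx_diag !mxE.
set S := mxinner _ _; set T := \sum_k _ in sum_dt *.
have SE : p * S = \sum_k \sum_i p * t 0 k `^ (p - 1) * d 0 i * (u k i * v k i).
  rewrite /S mxinner_Diag mulr_sumr; apply: eq_bigr => k _.
  by rewrite mxE WE !mulr_sumr; apply: eq_bigr => i _; rewrite /u /v; ring.
(* The terms recombine because [w k i - (u k i - v k i) ^+ 2 / 2 = u k i * v k i]. *)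
have gap : \sum_i d 0 i `^ p + (p - 1) * T - p * S =
    \sum_k \sum_i (w k i * Y k i + z k i) + \sum_i a i + \sum_k b k.
  have -> : \sum_i a i = \sum_i d 0 i `^ p - \sum_k \sum_i d 0 i `^ p * w k i.
    rewrite exchange_big -sumrB; apply: eq_bigr => i _.
    by rewrite /a mulrBr mulr1 mulr_sumr.
  have -> : \sum_k b k = (p - 1) * T - \sum_k \sum_i (p - 1) * t 0 k `^ p * w k i.
    rewrite mulr_sumr -sumrB; apply: eq_bigr => k _.
    by rewrite /b mulrBr mulr1 mulr_sumr.
  have -> : \sum_k \sum_i (w k i * Y k i + z k i) =
      \sum_k \sum_i d 0 i `^ p * w k i + \sum_k \sum_i (p - 1) * t 0 k `^ p * w k i - p * S.
    rewrite SE -big_split -sumrB; apply: eq_bigr => k _.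
    rewrite -big_split -sumrB; apply: eq_bigr => i _.
    by rewrite /Y /z /w /=; field.
  by ring.
have wYz_ge0 k i : 0 <= w k i * Y k i + z k i
  by apply: addr_ge0 => //; exact: mulr_ge0.
have sums_ge0 : [/\ 0 <= \sum_k \sum_i (w k i * Y k i + z k i),
    0 <= \sum_i a i & 0 <= \sum_k b k].
  by split; do ?[apply: sumr_ge0 => ? _ //].
have [wYz a0 b0] := sums_ge0.
have pST : p * S <= p * T by lra.
split; first by rewrite -(ler_pM2l p0).
(* With [S = T], [sum_dt] makes the left side of [gap] at most zero, so every nonnegative term on
   the right vanishes. *)
move=> ST; rewrite ST in gap.
have /eqP : \sum_k \sum_i (w k i * Y k i + z k i) = 0 by lra.
rewrite psumr_eq0 => [/allP wYz_eq0|k _]; last exact: sumr_ge0.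
have /eqP : \sum_i a i = 0 by lra.
rewrite psumr_eq0 // => /allP a_eq0.
have {}wYz_eq0 k i : w k i * Y k i + z k i = 0.
  have /= := wYz_eq0 k (mem_index_enum k); rewrite psumr_eq0 //.
  by move=> /allP/(_ i (mem_index_enum i))/eqP.
have {}a_eq0 i : a i = 0 by exact/eqP/(a_eq0 i)/mem_index_enum.
(* Either the weight vanishes, and [u k i = v k i = 0]; or equality in Young's inequality gives
   [d 0 i = t 0 k], and [z k i = 0] then gives [u k i = v k i] unless [t 0 k = 0]. *)
have term k l i : u k i * d 0 i * B l i = t 0 k * (v k i * B l i).
  have wY0 : w k i * Y k i = 0.
    by have := wYz_eq0 k i; have := z_ge0 k i; have := mulr_ge0 (w_ge0 k i) (Y_ge0 k i); lra.
  have z0 : z k i = 0 by have := wYz_eq0 k i; rewrite wY0 add0r.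
  have [w0|wn0] := eqVneq (w k i) 0.
    have : u k i ^+ 2 == 0 /\ v k i ^+ 2 == 0.
      by move: w0; rewrite /w; have := sqr_ge0 (u k i); have := sqr_ge0 (v k i);
        split; apply/eqP; lra.
    by rewrite !sqrf_eq0 => -[/eqP-> /eqP->]; rewrite !(mul0r, mulr0).
  have dt : d 0 i = t 0 k.
    have [_ /esym] := powR_young p1 (t_ge0 k) (d_ge0 i).
    move=> E; apply/eqP; rewrite E eq_sym -subr_eq0 -/(Y k i).
    by move/eqP: wY0; rewrite mulf_eq0 (negbTE wn0).
  have [t0|tn0] := eqVneq (t 0 k) 0; first by rewrite dt t0 !(mul0r, mulr0).
  have t_gt0 : 0 < t 0 k by rewrite lt0r tn0 t_ge0.
  have c_gt0 : 0 < p * t 0 k `^ (p - 1) * t 0 k.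
    by rewrite mulr_gt0 // mulr_gt0 ?powR_gt0.
  move/eqP: z0; rewrite /z dt mulf_eq0 gt_eqF //= mulf_eq0 invr_eq0 pnatr_eq0 orbF.
  by rewrite sqrf_eq0 subr_eq0 => /eqP->; ring.
apply/matrixP => k l; have [kmin|kmin] := ltnP k (minn m n); last first.
  rewrite Diag_ge // WE big1 // => i _.
  have [->|dn0] := eqVneq (d 0 i) 0; first by rewrite mulr0 mul0r.
  (* As [a i = 0] and [d 0 i] is nonzero, column [i] of [w] has full sum 1. The first [minn m n]
     entries then exhaust the squared length of column [i] of [A], which is at most 1. *)
  suff -> : A k i = 0 by rewrite !mul0r.
  have : \sum_k w k i = 1.
    move/eqP: (a_eq0 i); rewrite /a mulf_eq0 powR_eq0 (negbTE dn0) /=.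
    by rewrite subr_eq0 => /eqP.
  rewrite w_colE => uv; apply/eqP; rewrite -sqrf_eq0.
  have : A k i ^+ 2 + \sum_k u k i ^+ 2 <= 1.
    apply: le_trans (A_col i).
    rewrite [leRHS](bigID (fun k : 'I_m => (k < minn m n)%N)) /=.
    rewrite (big_ord_narrow (geq_minl m n)) /= [leRHS]addrC lerD2r.
    rewrite (bigD1 k) -?leqNgt //= lerDl.
    by apply: sumr_ge0 => j _; exact: sqr_ge0.
  have := sumv i; have := sqr_ge0 (A k i); move=> *; apply/eqP; lra.
have -> : k = widen_ord (geq_minl m n) (Ordinal kmin) by exact: val_inj.
(* By [term] the entry is [t 0 k] times the product of rows [k] and [l] of [B], which are
   orthonormal. *)
rewrite DiagE WE; under eq_bigr => i _ do rewrite -/(u _ _) term.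
rewrite -mulr_sumr -[RHS]mulr_natr.
have /matrixP/(_ (widen_ord (geq_minr m n) (Ordinal kmin)) l) := BBt.
rewrite !mxE -val_eqE /= => <-.
by congr (_ * _); apply: eq_bigr => i _; rewrite mxE.
Qed.

(** * Orthogonal invariance and membership in the Schatten ball *)

Lemma gram_orthogonal (R : realType) (m n : nat) (Y : 'M[R]_(m, n)) (U : 'M[R]_m)
    (V : 'M[R]_n) :
  orthogonal_mx U -> (U *m Y *m V^T)^T *m (U *m Y *m V^T) = V *m (Y^T *m Y) *m V^T.
Proof.
move=> UU; rewrite !trmx_mul trmxK -!mulmxA [U^T *m _]mulmxA UU mul1mx.
by rewrite !mulmxA.
Qed.

Lemma singvals_orthogonal (R : realType) (m n : nat) (Y : 'M[R]_(m, n)) (U : 'M[R]_m)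
    (V : 'M[R]_n) :
  orthogonal_mx U -> orthogonal_mx V -> singvals (U *m Y *m V^T) = singvals Y.
Proof.
move=> UU VV; pose Z := U *m Y *m V^T.
have charZ : char_poly (Z^T *m Z) = char_poly (Y^T *m Y).
  by rewrite gram_orthogonal // char_poly_orthogonal_conj.
have evZ : eigenvalues_desc (Z^T *m Z) = eigenvalues_desc (Y^T *m Y).
  by rewrite /eigenvalues_desc charZ.
by apply/rowP => k; rewrite [LHS]mxE [RHS]mxE evZ.
Qed.

(** The entries of [s] may be unsorted and of either sign, so only power sums of absolute values are
    compared. *)
Lemma sum_singvals_Diag (R : realType) (m n : nat) (p : R) (s : 'rV[R]_(minn m n)) :
  p != 0 -> \sum_k `|singvals (Diag s : 'M_(m, n)) 0 k| `^ p = \sum_k `|s 0 k| `^ p.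
Proof.
(* [d] is the diagonal of the Gram matrix: the squares of the entries of [s], padded with zeros to
   length [n]. *)
move=> p0; pose d : 'rV[R]_n := \row_j \sum_(k < minn m n | k == j :> nat) s 0 k ^+ 2.
have dE k : d 0 (widen_ord (geq_minr m n) k) = s 0 k ^+ 2.
  by rewrite mxE (big_pred1 k) // => i; apply/eqP/eqP => [/val_inj|->].
have d_ge (j : 'I_n) : (minn m n <= j)%N -> d 0 j = 0.
  move=> le_j; rewrite mxE big_pred0 // => k; apply: contraTF le_j => /eqP <-.
  by rewrite -ltnNge.
have sum_d (V : nmodType) (F : R -> V) : F 0 = 0 ->
    \sum_j F (d 0 j) = \sum_k F (s 0 k ^+ 2).
  move=> F0; rewrite (sum_widen_ord (geq_minr m n)) => [|j /d_ge->] //.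
  by apply: eq_bigr => k _; rewrite dE.
rewrite (sum_singvals (B := 1%:M) (d := d)) //.
- rewrite (sum_d _ (fun x => Num.sqrt x `^ p)) ?sqrtr0 ?powR0 //.
  by apply: eq_bigr => k _; rewrite sqrtr_sqr.
- by rewrite /orthogonal_mx trmx1 mul1mx.
- rewrite mul1mx trmx1 mulmx1; apply/matrixP => i j.
  rewrite [LHS]mxE (sum_widen_ord (geq_minl m n)) => [|k le_k]; last first.
    by rewrite [in X in _ * X]Diag_ge // mulr0.
  rewrite !mxE; under eq_bigr => k _ do rewrite mxE !DiagE.
  rewrite -sumrMnl [RHS]big_mkcond; apply: eq_bigr => k _ /=.
  have [ki|ki] := eqVneq (k : nat) i; last by rewrite mulr0n mul0r.
  by rewrite -[i == j]val_eqE /= -ki mulr1n mulrnAr.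
- by move=> j; rewrite mxE; apply: sumr_ge0 => k _; exact: sqr_ge0.
- rewrite -sum1_card big_mkcond /= (eq_bigr (fun j => (d 0 j != 0 :> R) : nat)).
    rewrite (sum_d nat (fun x => (x != 0) : nat)) ?eqxx //.
    rewrite -[leqRHS]card_ord -sum1_card; apply: leq_sum => k _; exact: leq_b1.
  by move=> j _; rewrite inE; case: eqP.
Qed.

Lemma schatten_leE (R : realType) (m n : nat) (p r : R) (Y : 'M[R]_(m, n)) :
  0 < p -> 0 <= r ->
  (schatten p Y <= r) = (\sum_k `|singvals Y 0 k| `^ p <= r `^ p).
Proof.
move=> p0 r0; rewrite /schatten /lpnorm; set x := \sum_k _.
have x0 : 0 <= x by apply: sumr_ge0 => k _; exact: powR_ge0.
have {2}-> : x = (x `^ p^-1) `^ p by rewrite -powRrM mulVf ?gt_eqF // powRr1.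
have [le_xr|lt_rx] := leP (x `^ p^-1) r.
  by apply/esym; apply: ge0_ler_powR; rewrite ?nnegrE ?powR_ge0 ?(ltW p0).
by apply/esym/negbTE; rewrite -ltNge gt0_ltr_powR ?nnegrE ?powR_ge0.
Qed.

(** * The minimiser of a linear objective over the Schatten ball *)

(** For [C = 0] the objective is constant and every point of the ball is a minimiser, so uniqueness
    is claimed for [C != 0] only. *)
Theorem lemma7 (R : realType) (m n : nat) (p q r : R)
  (hp1 : 1 < p) (hp2 : p <= 2) (hr : 0 < r) (hpq : q^-1 + p^-1 = 1)
  (C : 'M[R]_(m, n)) (U : 'M[R]_m) (V : 'M[R]_n) (hC : is_svd C U V)
  (s : 'rV[R]_(minn m n))
  (hs : forall i, s 0 i =
     - (r / lpnorm q (singvals C) `^ (q - 1)) * singvals C 0 i `^ (q - 1))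
  (X : 'M[R]_(m, n)) (hX : X = U *m Diag s *m V^T) :
  argmin (schatten_ball p r) (fun Y => mxinner Y C) X /\
  (C != 0 -> argmin (schatten_ball p r) (fun Y => mxinner Y C) = [set X]).
Proof.
case: hC => UU VV EC.
have p0 : 0 < p by exact: lt_trans hp1.
have pn0 : p != 0 by rewrite gt_eqF.
have qV : q^-1 = 1 - p^-1 by rewrite -hpq addrK.
have qV_gt0 : 0 < q^-1 by rewrite qV subr_gt0 invf_lt1.
have q0 : 0 < q by rewrite -invr_gt0.
have qn0 : q != 0 by rewrite gt_eqF.
have pq : (q - 1) * p = q.
  have : q * p * (q^-1 + p^-1) = q * p by rewrite hpq mulr1.
  have -> : q * p * (q^-1 + p^-1) = p + q by field; rewrite pn0.
  by move=> E; rewrite mulrBl -E; ring.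
have q1p1 : (q - 1) * (p - 1) = 1 by rewrite mulrBr pq; ring.
have q1 : q - 1 != 0 by apply: contraNneq qn0 => q1; rewrite -pq q1 mul0r.
have sg_ge0 k : 0 <= singvals C 0 k by rewrite mxE sqrtr_ge0.
move: (singvals C) sg_ge0 hs EC => sg sg_ge0 hs EC.
pose Q := \sum_k sg 0 k `^ q.
have Q_ge0 : 0 <= Q by apply: sumr_ge0 => k _; exact: powR_ge0.
pose kappa := r / (Q `^ q^-1) `^ (q - 1).
have kappa_ge0 : 0 <= kappa by rewrite divr_ge0 ?powR_ge0 ?ltW.
pose t : 'rV[R]_(minn m n) := - s.
have tE k : t 0 k = kappa * sg 0 k `^ (q - 1).
  have normE : lpnorm q sg = Q `^ q^-1.
    by congr (_ `^ _); apply: eq_bigr => i _; rewrite ger0_norm.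
  by rewrite mxE hs normE mulNr opprK.
have t_ge0 k : 0 <= t 0 k by rewrite tE mulr_ge0 ?powR_ge0.
have sum_t : \sum_k t 0 k `^ p = kappa `^ p * Q.
  rewrite mulr_sumr; apply: eq_bigr => k _.
  by rewrite tE powRM ?powR_ge0 // -powRrM pq.
(* Since [q^-1 * (q - 1) * p = 1], the scaling by [kappa] puts [t] on the sphere of radius [r]. *)
have kappaQ : Q != 0 -> kappa `^ p * Q = r `^ p.
  move=> Qn0; rewrite /kappa powRM ?invr_ge0 ?powR_ge0 ?(ltW hr) //.
  rewrite -powR_inv1 ?powR_ge0 // -!powRrM.
  have -> : q^-1 * ((q - 1) * (-1 * p)) = - 1.
    by rewrite mulN1r mulrN pq mulrN mulVf.
  by rewrite powR_inv1 // divfK.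
have sum_t_le : \sum_k t 0 k `^ p <= r `^ p.
  rewrite sum_t; have [->|/kappaQ->//] := eqVneq Q 0.
  by rewrite mulr0 powR_ge0.
have X_ball : schatten_ball p r X.
  rewrite /schatten_ball /= schatten_leE ?(ltW hr) // hX singvals_orthogonal //.
  rewrite sum_singvals_Diag //; apply: le_trans sum_t_le.
  by apply: ler_sum => k _; rewrite -normrN -(ger0_norm (t_ge0 k)) mxE.
have [Q0|Qn0] := eqVneq Q 0.
  have C0 : C = 0.
    suff -> : C = U *m Diag (0 : 'rV[R]_(minn m n)) *m V^T.
      rewrite (_ : Diag _ = 0) ?mulmx0 ?mul0mx //.
      by apply/matrixP => i j; rewrite !mxE big1 // => k _; rewrite mxE.
    rewrite {1}EC; congr (_ *m Diag _ *m _); apply/rowP => k; rewrite [RHS]mxE.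
    move/eqP: Q0; rewrite psumr_eq0 => [|i _]; last exact: powR_ge0.
    by move/allP/(_ k (mem_index_enum k)); rewrite /= powR_eq0 qn0 andbT => /eqP.
  by rewrite C0 eqxx; split=> //; split=> // Y _; rewrite /mxinner !mulmx0.
(* The sign turns minimisation into maximisation; [V^T^T] gives [W Y] the shape to which orthogonal
   invariance applies. *)
pose W Y := (- U^T) *m Y *m V^T^T.
have NUU : orthogonal_mx (- U^T).
  rewrite /orthogonal_mx [(- _)^T]raddfN /= trmxK mulNmx mulmxN opprK.
  exact: mulmx1C.
have VtVt : orthogonal_mx V^T.
  by rewrite /orthogonal_mx trmxK; exact: mulmx1C.
have WK Y : (- U) *m W Y *m V^T = Y.
  rewrite /W trmxK !(mulmxN, mulNmx) opprK !mulmxA (mulmx1C UU) mul1mx.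
  by rewrite -mulmxA (mulmx1C VV) mulmx1.
have WX : W X = Diag t.
  rewrite /W hX trmxK !mulNmx !mulmxA UU mul1mx -mulmxA VV mulmx1.
  by apply/matrixP => i j; rewrite !mxE -sumrN; apply: eq_bigr => k _; rewrite mxE.
have innerW Y : mxinner Y C = - mxinner (W Y) (Diag sg).
  have WT : (W Y)^T = - (V^T *m Y^T *m U).
    by rewrite /W trmxK !mulNmx raddfN /= !trmx_mul trmxK mulmxA.
  rewrite /mxinner WT mulNmx raddfN /= opprK EC !mulmxA.
  by rewrite mxtrace_mulC !mulmxA.
have kappa_gt0 : 0 < kappa.
  by rewrite divr_gt0 // !powR_gt0 // lt0r Qn0.
pose c := kappa `^ (p - 1); have c_gt0 : 0 < c by exact: powR_gt0.
(* As [(q - 1) * (p - 1) = 1], the power [p - 1] of [t] is proportional to [sg]. *)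
have t_sg Z : mxinner Z (Diag (\row_k t 0 k `^ (p - 1))) = c * mxinner Z (Diag sg).
  rewrite !mxinner_Diag mulr_sumr; apply: eq_bigr => k _.
  by rewrite mxE tE powRM ?powR_ge0 // -powRrM q1p1 powRr1 // mulrA.
have W_ball Y : schatten_ball p r Y ->
    \sum_k `|singvals (W Y) 0 k| `^ p <= \sum_k t 0 k `^ p.
  by rewrite /schatten_ball /= schatten_leE ?(ltW hr) // singvals_orthogonal // sum_t kappaQ.
have innerX : c * mxinner (W X) (Diag sg) = \sum_k t 0 k `^ p.
  rewrite -t_sg WX mxinner_Diag; apply: eq_bigr => k _.
  by rewrite DiagE eqxx mulr1n mxE mulrC mulr_powRB1.
have X_min Y : schatten_ball p r Y -> mxinner X C <= mxinner Y C.
  move=> /W_ball/(schatten_duality hp1 t_ge0)[+ _].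
  by rewrite t_sg -innerX ler_pM2l // !innerW lerN2.
split=> // _; apply/seteqP; split=> [Y [Y_ball Y_min]|_ ->] //=.
(* Another minimiser has the same value as [X], hence attains the duality bound, and the equality
   case identifies [W Y] with [W X]. *)
have /(schatten_duality hp1 t_ge0)[_ Y_eq] := W_ball _ Y_ball.
rewrite -(WK Y) Y_eq -?WX ?WK //.
rewrite t_sg -innerX; congr (c * _); apply: oppr_inj; rewrite -!innerW.
by apply/le_anti; rewrite Y_min //= X_min.
Qed.
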